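(* For integers $n,m\geq 3$ let $T^t(n,m)$, $T^c(n,m)$, $T^f(n,m)$ be the triangular lattices with toroidal, cylindrical and free boundary conditions defined below. Then, as $n$ and $m$ both tend to infinity, $$\lim_{n,m\rightarrow \infty}\frac{\mathcal E(T^t(n,m))}{nm}=\lim_{n,m\rightarrow \infty}\frac{\mathcal E(T^c(n,m))}{nm}=\lim_{n,m\rightarrow \infty}\frac{\mathcal E(T^f(n,m))}{nm}=\frac{1}{2\pi^2}\int_0^{2\pi}\int_0^{2\pi}|\cos x+\cos y+\cos(x+y)|\,dx\,dy .$$
   Context: For a finite simple graph $G$ with adjacency matrix $A(G)$, the energy $\mathcal E(G)$ is the sum of the absolute values of all eigenvalues of $A(G)$ (counted with multiplicity). All three graphs below have vertex set $\{0,\dots,n-1\}\times\{0,\dots,m-1\}$. The toroidal triangular lattice $T^t(n,m)$ has edges joining $(i,j)$ to $(i,j+1)$, to $(i+1,j)$, and to $(i+1,j+1)$ for all $i,j$, where the first coordinate is taken mod $n$ and the second mod $m$ (i.e. an $n\times m$ toroidal square lattice with the same diagonal added in every square). The cylindrical lattice $T^c(n,m)$ has the same edges except that the second coordinate is not taken mod $m$: $(i,j)\sim(i,j+1)$ and $(i,j)\sim(i+1 \bmod n,j+1)$ only for $0\le j\le m-2$, and $(i,j)\sim(i+1\bmod n,j)$ for all $j$. The free lattice $T^f(n,m)$ has no wrap-around in either coordinate: $(i,j)\sim(i,j+1)$ for $j\le m-2$, $(i,j)\sim(i+1,j)$ for $i\le n-2$, and $(i,j)\sim(i+1,j+1)$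 for $i\le n-2$, $j\le m-2$. The limit $n,m\to\infty$ is the joint limit (for every $\varepsilon>0$ there is $N$ such that the quantity is within $\varepsilon$ of the limit whenever $n,m\ge N$). *)

(* Defs.v *)
From mathcomp Require Import all_boot all_order all_algebra.
From mathcomp Require Import complex.

Set Implicit Arguments.
Unset Strict Implicit.
Unset Printing Implicit Defensive.

Import GRing.Theory.

Local Open Scope ring_scope.

Record sgraph := SGraph {
  vertex : finType;
  adj : rel vertex;
  adj_sym : symmetric adj;
  adj_irr : irreflexive adj }.

Definition adjmx (K : nzRingType) (G : sgraph) : 'M[K]_#|vertex G| :=
  \matrix_(i, j) (adj (enum_val i) (enum_val j))%:R.

(* The eigenvalues are listed with their algebraic multiplicity, as the
   roots of the (monic) characteristic polynomial. *)
Definition eigenvalues (K : closedFieldType) n (A : 'M[K]_n) : seq K :=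
  sval (closed_field_poly_normal (char_poly A)).

(* The eigenvalues are taken in R[i]; [Normc.normc] is the R-valued modulus. *)
Definition energy (R : rcfType) (G : sgraph) : R :=
  \sum_(z <- eigenvalues (adjmx R[i] G)) Normc.normc z.

Definition sym_adj (T : finType) (arc : rel T) : rel T :=
  fun x y => (x != y) && (arc x y || arc y x).

Lemma sym_adj_sym (T : finType) (arc : rel T) : symmetric (sym_adj arc).
Proof. by move=> x y; rewrite /sym_adj eq_sym orbC. Qed.

Lemma sym_adj_irr (T : finType) (arc : rel T) : irreflexive (sym_adj arc).
Proof. by move=> x; rewrite /sym_adj eqxx. Qed.

Definition sgraph_of_arcs (T : finType) (arc : rel T) : sgraph :=
  SGraph (sym_adj_sym arc) (sym_adj_irr arc).

(* [b] is the successor of [a] in the cycle (resp. path) 0, ..., n - 1. *)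
Definition cycle_succ n : rel 'I_n := fun a b => (b : nat) == (a.+1 %% n)%N.
Definition path_succ n : rel 'I_n := fun a b => (b : nat) == a.+1%N.

(* Arcs from (i, j) to (i, j + 1), (i + 1, j) and (i + 1, j + 1), the
   increments being taken with respect to [sn] and [sm]. *)
Definition tri_arc n m (sn : rel 'I_n) (sm : rel 'I_m) : rel ('I_n * 'I_m) :=
  fun x y => [|| (x.1 == y.1) && sm x.2 y.2,
                 sn x.1 y.1 && (x.2 == y.2)
               | sn x.1 y.1 && sm x.2 y.2].

Definition Tt n m := sgraph_of_arcs (tri_arc (@cycle_succ n) (@cycle_succ m)).
Definition Tc n m := sgraph_of_arcs (tri_arc (@cycle_succ n) (@path_succ m)).
Definition Tf n m := sgraph_of_arcs (tri_arc (@path_succ n) (@path_succ m)).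

(* Main.v *)
(* The toroidal adjacency matrix is diagonalised by the discrete Fourier basis,
   with eigenvalues 2 (cos a_i + cos b_j + cos (a_i + b_j)), a_i = 2 pi i / n and
   b_j = 2 pi j / m, so its energy per site is a Riemann sum of a Lipschitz
   function.  For normal A, the trace norm is tr (S A) with S the adjoint of the
   phase of A; as S is a contraction, it follows that
   |E(A) - E(B)| <= sum_(i, j) |A_ij - B_ij|.  Opening the boundary removes at most
   3 (n + m) edges, hence changes the energy per site by O(1/n + 1/m). *)
Require Import Defs.
From mathcomp Require Import all_boot all_order all_algebra.
From mathcomp Require Import complex ring lra.
From mathcomp Require Import all_classical all_reals all_analysis.

Set Implicit Arguments.
Unset Strict Implicit.
Unset Printing Implicit Defensive.

Import Order.TTheory GRing.Theory Num.Theory.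
Import numFieldNormedType.Exports.

Local Open Scope ring_scope.

(** * Spectrum of a diagonalised matrix *)

(** [P] also intertwines the two characteristic matrices. Taking determinants and cancelling the
    nonzero [\det P] identifies the characteristic polynomials, and a product of monic linear
    factors determines its roots up to order. *)
Lemma eigenvalues_diagonalized (K : closedFieldType) n (A P : 'M[K]_n) (d : 'rV_n) :
  P \in unitmx -> P *m A = diag_mx d *m P ->
  perm_eq (eigenvalues A) [seq d 0 i | i <- enum 'I_n].
Proof.
move=> Pu PA; apply: prod_XsubC_eq.
rewrite /eigenvalues; case: closed_field_poly_normal => s /= sE.
rewrite [LHS](_ : _ = char_poly A); last first.
  by rewrite sE (monicP (char_poly_monic A)) scale1r.
rewrite big_map big_enum /=.
have -> : char_poly A = char_poly (diag_mx d).
  have E : map_mx polyC P *m char_poly_mx A =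
           char_poly_mx (diag_mx d) *m map_mx polyC P.
    by rewrite /char_poly_mx mulmxBr mulmxBl -!map_mxM PA scalar_mxC.
  have := congr1 determinant E; rewrite !det_mulmx mulrC.
  by apply/mulIf; rewrite det_map_mx polyC_eq0 -unitfE -unitmxE.
rewrite char_poly_trig; last first.
  by apply/is_trig_mxP => i j; rewrite mxE => /ltn_eqF; rewrite -val_eqE => ->.
by apply: eq_bigr => i _; rewrite mxE eqxx.
Qed.

Lemma sum_eigenvalues_diagonalized (V : nmodType) (K : closedFieldType) n
   (A P : 'M[K]_n) (d : 'rV_n) (f : K -> V) :
  P \in unitmx -> P *m A = diag_mx d *m P ->
  \sum_(z <- eigenvalues A) f z = \sum_i f (d 0 i).
Proof.
move=> Pu /(eigenvalues_diagonalized Pu)/(perm_big _) -> /=.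
by rewrite big_map big_enum.
Qed.

(** * Perturbation of the trace norm of normal matrices *)

Section TraceNorm.
Local Open Scope sesquilinear_scope.
Variables (C : numClosedFieldType).

(** The entry is a sum over [k] of terms of modulus at most [|U k i| |U k j|]. The inequality of
    arithmetic and geometric means bounds each by half the sum of the squares, and the columns of
    [U] have norm 1. *)
Lemma unitary_conj_diag_entry n (U : 'M[C]_n) (s : 'rV_n) i j :
  U \is unitarymx -> (forall k, `|s 0 k| <= 1) ->
  `|(U^t* *m diag_mx s *m U) i j| <= 1.
Proof.
move=> Uu s1.
have col1 k : \sum_l `|U l k| ^+ 2 = 1.
  have := Uu; rewrite -trmxC_unitary => /unitarymxP/matrixP/(_ k k).
  rewrite trmxCK !mxE eqxx => E; rewrite -[RHS]E; apply: eq_bigr => l _.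
  by rewrite !mxE normCK mulrC.
rewrite mxE (le_trans (ler_norm_sum _ _ _))//.
apply: (@le_trans _ _ (\sum_l (`|U l i| ^+ 2 + `|U l j| ^+ 2) / 2)).
  apply: ler_sum => k _.
  rewrite mul_mx_diag !mxE !normrM norm_conjC.
  apply: (@le_trans _ _ (`|U k i| * `|U k j|)).
    rewrite ler_wpM2r// -[leRHS]mulr1 ler_wpM2l//.
  rewrite ler_pdivlMr//; rewrite -subr_ge0.
  rewrite [X in 0 <= X](_ : _ = (`|U k i| - `|U k j|) ^+ 2).
    by rewrite real_exprn_even_ge0// realB// normr_real.
  by rewrite sqrrB mulr_natr addrAC.
by rewrite -mulr_suml big_split/= !col1 -[1 + 1]/(2%:R) divff ?pnatr_eq0.
Qed.

Lemma trace_norm_le n (A B : 'M[C]_n) : A \is normalmx -> B \is normalmx ->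
  \sum_(z <- eigenvalues A) `|z| <=
  \sum_(z <- eigenvalues B) `|z| + \sum_i \sum_j `|A i j - B i j|.
Proof.
move=> /orthomx_spectralP; set U := spectralmx A; set d := spectral_diag A => AE.
move=> /orthomx_spectralP; set V := spectralmx B; set e := spectral_diag B => BE.
have Uu : U \is unitarymx := spectral_unitarymx A.
have Vu : V \is unitarymx := spectral_unitarymx B.
rewrite (sum_eigenvalues_diagonalized (P := U) (d := d)) ?unitarymx_unit//; last first.
  by rewrite AE !mulmxA mulmxV ?mul1mx ?unitarymx_unit.
rewrite (sum_eigenvalues_diagonalized (P := V) (d := e)) ?unitarymx_unit//; last first.
  by rewrite BE !mulmxA mulmxV ?mul1mx ?unitarymx_unit.
(* Conjugate phases of the eigenvalues of [A]. At a zero eigenvalue the division by 0 yields 0,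
   hence a bound [<= 1] in [s1] rather than an equality. *)
pose s : 'rV[C]_n := \row_k ((d 0 k)^* / `|d 0 k|).
have s1 k : `|s 0 k| <= 1.
  rewrite mxE normrM normfV normr_id norm_conjC.
  by have [->|d0] := eqVneq (d 0 k) 0; rewrite ?normr0 ?mul0r// divff// normr_eq0.
pose S := U^t* *m diag_mx s *m U.
have trSA : \tr (S *m A) = \sum_k `|d 0 k|.
  rewrite AE invmx_unitary// /S -!mulmxA mxtrace_mulC !mulmxA.
  rewrite !mulmxtVK// mulmx_diag mxtrace_diag.
  apply: eq_bigr => k _; rewrite !mxE mulrAC -normCKC expr2.
  by have [->|d0] := eqVneq (d 0 k) 0; rewrite ?normr0 ?mul0r// mulfK// normr_eq0.
have trSB : `|\tr (S *m B)| <= \sum_k `|e 0 k|.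
  (* [W] is [S] written in the eigenbasis of [B]. It is again a unitary conjugate of [diag_mx s], so
     its diagonal entries have modulus at most 1. *)
  pose W := (U *m V^t*)^t* *m diag_mx s *m (U *m V^t*).
  have -> : \tr (S *m B) = \sum_k W k k * e 0 k.
    rewrite BE invmx_unitary// mulmxA mxtrace_mulC !mulmxA.
    rewrite [X in \tr X](_ : _ = W *m diag_mx e); last first.
      by rewrite /W trmx_mul map_mxM trmxCK !mulmxA.
    by rewrite mul_mx_diag; apply: eq_bigr => k _; rewrite mxE.
  rewrite (le_trans (ler_norm_sum _ _ _))//; apply: ler_sum => k _.
  rewrite normrM -[leRHS]mul1r ler_wpM2r// unitary_conj_diag_entry//.
  by rewrite mul_unitarymx// trmxC_unitary.
rewrite -trSA -{1}[A](subrK B) mulmxDr mxtraceD addrC.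
(* The sum is [\tr (S *m A)], a nonnegative real, so a modulus can be inserted and the triangle
   inequality applied. *)
have -> : \tr (S *m B) + \tr (S *m (A - B)) = `|\tr (S *m B) + \tr (S *m (A - B))|.
  by rewrite -mxtraceD -mulmxDr addrC subrK trSA ger0_norm ?sumr_ge0.
rewrite (le_trans (ler_normD _ _))// lerD//.
rewrite exchange_big/= (le_trans (ler_norm_sum _ _ _))//; apply: ler_sum => i _.
rewrite mxE (le_trans (ler_norm_sum _ _ _))//; apply: ler_sum => j _.
by rewrite normrM -[leRHS]mul1r ler_pM// ?unitary_conj_diag_entry// !mxE.
Qed.
End TraceNorm.

(** * Change of the energy when edges are removed *)

Section Energy.
Variable R : rcfType.

Lemma energyE (G : sgraph) :
  (energy R G)%:C%C = \sum_(z <- eigenvalues (adjmx R[i] G)) `|z|.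
Proof. by rewrite /energy rmorph_sum; apply: eq_bigr. Qed.

Lemma adjmx_normal (C : numClosedFieldType) (G : sgraph) : adjmx C G \is normalmx.
Proof.
apply: symmetric_normalmx.
  apply/is_hermitianmxP; rewrite expr0 scale1r.
  by apply/matrixP => i j; rewrite !mxE adj_sym.
by apply/mxOverP => i j; rewrite mxE realn.
Qed.

(** Both adjacency matrices are real symmetric, hence normal, and an entry of their difference has
    modulus 1 exactly where the adjacencies disagree. *)
Lemma energy_le (T : finType) (a1 a2 : rel T) :
  energy R (sgraph_of_arcs a1) <= energy R (sgraph_of_arcs a2) +
    (\sum_x \sum_y (sym_adj a1 x y (+) sym_adj a2 x y : nat))%:R.
Proof.
rewrite -lecR rmorphD/= !energyE rmorph_nat.
apply: le_trans (trace_norm_le (adjmx_normal R[i] (sgraph_of_arcs a1))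
                                (adjmx_normal R[i] (sgraph_of_arcs a2))) _.
rewrite lerD2l (reindex _ (onW_bij _ (@enum_val_bij T)))/= natr_sum.
apply: ler_sum => i _.
rewrite (reindex _ (onW_bij _ (@enum_val_bij T)))/= natr_sum.
apply: ler_sum => j _; rewrite !mxE /=.
by do 2!case: sym_adj; rewrite ?subrr ?subr0 ?sub0r ?normrN ?normr0 ?normr1.
Qed.

(** The factor 2 comes from symmetrisation: a lost arc affects the ordered pairs [(x, y)] and
    [(y, x)]. One of the two copies of the sum is therefore transposed before comparing termwise. *)
Lemma sym_adj_diff_le (T : finType) (a1 a2 : rel T) : subrel a2 a1 ->
  (\sum_x \sum_y (sym_adj a1 x y (+) sym_adj a2 x y) <=
   2 * \sum_x \sum_y (a1 x y && ~~ a2 x y))%N.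
Proof.
move=> a21; rewrite mul2n -addnn [X in (_ <= _ + X)%N]exchange_big /= -big_split.
apply: leq_sum => x _; rewrite -big_split; apply: leq_sum => y _ /=.
rewrite /sym_adj; have := a21 x y; have := a21 y x.
rewrite eq_sym; case: (y == x) => //=.
case: (a1 x y); case: (a1 y x); case: (a2 x y); case: (a2 y x) => //= h1 h2;
  by [have := h1 isT | have := h2 isT].
Qed.

Lemma energy_diff_le (T : finType) (a1 a2 : rel T) : subrel a2 a1 ->
  `|energy R (sgraph_of_arcs a1) - energy R (sgraph_of_arcs a2)| <=
  (2 * \sum_x \sum_y (a1 x y && ~~ a2 x y))%:R.
Proof.
move=> a21; have le := sym_adj_diff_le a21.
rewrite ler_norml lerBlDl lerBrDl lerBlDr; apply/andP; split.
  apply: le_trans (energy_le a2 a1) _; rewrite lerD2l ler_nat; apply: leq_trans le.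
  by apply: leq_sum => x _; apply: leq_sum => y _; rewrite addbC.
by apply: le_trans (energy_le a1 a2) _; rewrite lerD2l ler_nat.
Qed.
End Energy.

(** * Counting the arcs lost at the boundary *)

Lemma sum_ord_eq_le1 n k : (\sum_(i < n) ((i : nat) == k) <= 1)%N.
Proof.
rewrite -big_mkcond sum1_card; apply/card_le1P => i /eqP <- j.
by rewrite inE -val_eqE.
Qed.

Lemma path_sub_cycle_succ n : subrel (@path_succ n) (@cycle_succ n).
Proof. by move=> a b /eqP ab; rewrite /cycle_succ ab modn_small// -ab. Qed.

Lemma cycle_path_succ n (a b : 'I_n) : cycle_succ a b -> ~~ path_succ a b -> a.+1 == n.
Proof.
rewrite /cycle_succ /path_succ => /eqP ->; apply: contraR => an.
by rewrite modn_small// ltn_neqAle an ltn_ord.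
Qed.

Lemma tri_arc_sub n m (sn sn' : rel 'I_n) (sm sm' : rel 'I_m) :
  subrel sn sn' -> subrel sm sm' -> subrel (tri_arc sn sm) (tri_arc sn' sm').
Proof.
move=> hn hm x y /or3P[]/andP[h1 h2]; apply/or3P.
- by constructor 1; rewrite h1 hm.
- by constructor 2; rewrite hn.
- by constructor 3; rewrite hn ?hm.
Qed.

(** Each of the three kinds of arc determines both coordinates of its target, so it contributes at
    most 1. *)
Lemma tri_arc_outdeg n m (x : 'I_n * 'I_m) :
  (\sum_y tri_arc (@cycle_succ n) (@cycle_succ m) x y <= 3)%N.
Proof.
have le (f : 'I_n -> bool) (g : 'I_m -> bool) : (\sum_i f i <= 1 -> \sum_j g j <= 1 ->
    \sum_(y : 'I_n * 'I_m) (f y.1 && g y.2) <= 1)%N.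
  move=> f1 g1; apply: leq_trans (leq_mul f1 g1).
  rewrite big_distrl /= -(pair_big predT predT (fun i j => f i && g j : nat))/=.
  apply: leq_sum => i _; rewrite big_distrr/=; apply: leq_sum => j _.
  by rewrite mulnb.
rewrite -[3%N]/(1 + 1 + 1)%N.
have e1 k (i : 'I_k) : (\sum_j (i == j) <= 1)%N.
  by under eq_bigr do rewrite eq_sym; apply: sum_ord_eq_le1.
have := leq_add (leq_add (le _ _ (e1 _ x.1) (sum_ord_eq_le1 _ (x.2.+1 %% m)%N))
  (le _ _ (sum_ord_eq_le1 _ (x.1.+1 %% n)%N) (e1 _ x.2)))
   (le _ _ (sum_ord_eq_le1 _ (x.1.+1 %% n)%N) (sum_ord_eq_le1 _ (x.2.+1 %% m)%N)).
apply: leq_trans.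
rewrite -!big_split; apply: leq_sum => y _ /=; rewrite /tri_arc /cycle_succ.
by do 3!case: (_ && _).
Qed.

(** A missing arc must start where one of the coordinates is maximal. There are at most [n + m] such
    vertices, counted with multiplicity, each with at most 3 outgoing arcs. *)
Lemma tri_arc_missing n m (sn : rel 'I_n) (sm : rel 'I_m) :
  subrel (@path_succ n) sn -> subrel (@path_succ m) sm ->
  (\sum_x \sum_y (tri_arc (@cycle_succ n) (@cycle_succ m) x y && ~~ tri_arc sn sm x y)
    <= 3 * (n + m))%N.
Proof.
move=> hn hm.
apply: (@leq_trans (\sum_(x : 'I_n * 'I_m) 3 * ((x.1.+1 == n) + (x.2.+1 == m)))).
  apply: leq_sum => x _; rewrite mulnC.
  apply: leq_trans (leq_mul (leqnn _) (tri_arc_outdeg x)).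
  rewrite big_distrr /=; apply: leq_sum => y _.
  case: (boolP (_ && _)) => // /andP[txy ntxy]; rewrite txy muln1 addn_gt0 !lt0b.
  apply: contraR ntxy; rewrite negb_or => /andP[nx1 nx2].
  have s1 : cycle_succ x.1 y.1 -> sn x.1 y.1.
    by move=> /cycle_path_succ h; apply: hn; apply: contraR nx1.
  have s2 : cycle_succ x.2 y.2 -> sm x.2 y.2.
    by move=> /cycle_path_succ h; apply: hm; apply: contraR nx2.
  case/or3P: txy => /andP[h1 h2]; apply/or3P.
  - by constructor 1; rewrite h1 s2.
  - by constructor 2; rewrite s1.
  - by constructor 3; rewrite s1 ?s2.
rewrite -big_distrr leq_mul2l /= big_split/= addnC.
rewrite -(pair_big predT predT (fun (i : 'I_n) (j : 'I_m) => (i.+1 == n) : nat))/=.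
rewrite -(pair_big predT predT (fun (i : 'I_n) (j : 'I_m) => (j.+1 == m) : nat))/=.
rewrite [X in (_ + X)%N]exchange_big/=.
have le k l : (\sum_(i < k) \sum_(j < l) (j.+1 == l) <= k)%N.
  rewrite -[leqRHS]muln1 -[in leqRHS](card_ord k) -sum_nat_const.
  (* For a successor [l.+1], the test [j.+1 == l.+1] is [j == l] by computation, which is what
     [sum_ord_eq_le1] counts. *)
  apply: leq_sum => i _; case: l => [|l]; first by rewrite big_ord0.
  exact: sum_ord_eq_le1.
exact: leq_add (le _ _) (le _ _).
Qed.

Lemma energy_torus_diff (R : rcfType) n m (sn : rel 'I_n) (sm : rel 'I_m) :
  subrel (@path_succ n) sn -> subrel sn (@cycle_succ n) ->
  subrel (@path_succ m) sm -> subrel sm (@cycle_succ m) ->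
  `|energy R (Tt n m) - energy R (sgraph_of_arcs (tri_arc sn sm))| <= (6 * (n + m))%:R.
Proof.
move=> hn hn' hm hm'; apply: le_trans (energy_diff_le _ (tri_arc_sub hn' hm')) _.
by rewrite ler_nat -[6%N]/(2 * 3)%N -mulnA leq_mul2l tri_arc_missing.
Qed.

(** * Roots of unity and Fourier diagonalisation of the torus *)

Lemma prim_root_neq0 (F : fieldType) n (z : F) : n.-primitive_root z -> z != 0.
Proof.
move=> zP; apply: contra_eq_neq (prim_expr_order zP) => ->.
by rewrite expr0n gtn_eqF ?(prim_order_gt0 zP)// eq_sym oner_eq0.
Qed.

(** This is a geometric sum of ratio [u], with [u ^+ n = 1]. If [a] and [b] differ then [u] is not
    1, and multiplying the sum by [u - 1] gives [u ^+ n - 1 = 0]. *)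
Lemma prim_root_orthogonality (F : fieldType) n (z : F) (a b : 'I_n) :
  n.-primitive_root z ->
  \sum_(i < n) z ^+ (a * i) * z ^- (b * i) = (n * (a == b))%:R.
Proof.
move=> zP; pose u := z ^+ a / z ^+ b.
have z0 k : z ^+ k != 0.
  by rewrite expf_neq0// (prim_root_neq0 zP).
transitivity (\sum_(i < n) u ^+ i).
  by apply: eq_bigr => i _; rewrite expr_div_n !exprM.
have [ab|ab] := eqVneq a b.
  rewrite /u ab; under eq_bigr do rewrite divff// expr1n.
  by rewrite sumr_const card_ord muln1.
have u1 : u - 1 != 0.
  rewrite subr_eq0 -(inj_eq (mulIf (z0 b))) divfK// mul1r (eq_prim_root_expr zP).
  by rewrite !modn_small.
rewrite muln0; apply: (mulfI u1); rewrite -subrX1 mulr0 expr_div_n -!exprM.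
rewrite mulnC exprM (prim_expr_order zP) mulnC exprM (prim_expr_order zP).
by rewrite !expr1n divr1 subrr.
Qed.

Lemma sum_enum_val (V : nmodType) (T : finType) (F : T -> V) :
  \sum_(i < #|T|) F (enum_val i) = \sum_x F x.
Proof. by rewrite [RHS](reindex _ (onW_bij _ (@enum_val_bij T))). Qed.

Lemma cycle_succE n (a b : 'I_n) : cycle_succ a b = (b == ordS a).
Proof. by []. Qed.

Lemma modn_add_neq n (a k : nat) :
  (a < n)%N -> (0 < k < n)%N -> ((a + k) %% n == a)%N = false.
Proof.
move=> an /andP[k0 kn]; have := eqn_modDl a k 0 n.
by rewrite addn0 mod0n (modn_small an) (modn_small kn) eqn0Ngt k0.
Qed.

Lemma ordS_neq n (a : 'I_n) : (1 < n)%N -> (ordS a == a) = false.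
Proof. by move=> n1; rewrite -val_eqE /= -addn1 modn_add_neq. Qed.

Lemma ord_pred_neq n (a : 'I_n) : (1 < n)%N -> (ord_pred a == a) = false.
Proof. by move=> n1; rewrite -(inj_eq (@ordS_inj n)) ord_predK eq_sym ordS_neq. Qed.

Lemma ordS_neq_pred n (a : 'I_n) : (2 < n)%N -> (ordS a == ord_pred a) = false.
Proof.
move=> n2; rewrite -(inj_eq (@ordS_inj n)) ord_predK -val_eqE /= -addn1 -(addn1 a).
by rewrite modnDml -addnA modn_add_neq.
Qed.

(** Since [n] and [m] exceed 2, the predecessor, the element itself and the successor are distinct
    in each cycle, so the six listed neighbours are pairwise distinct. *)
Lemma adj_Tt_sum (V : pzRingType) n m (f : 'I_n * 'I_m -> V) (a : 'I_n) (b : 'I_m) :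
  (2 < n)%N -> (2 < m)%N ->
  \sum_y f y * (adj (s := Tt n m) y (a, b))%:R =
  \sum_(y <- [:: (a, ordS b); (ordS a, b); (ordS a, ordS b);
                 (a, ord_pred b); (ord_pred a, b); (ord_pred a, ord_pred b)]) f y.
Proof.
move=> n2 m2; set r := [:: _; _; _; _; _; _].
have n1 : (1 < n)%N := ltnW n2. have m1 : (1 < m)%N := ltnW m2.
have ne := (ordS_neq, ord_pred_neq, ordS_neq_pred,
  fun k (c : 'I_k) (h : (1 < k)%N) => etrans (eq_sym c (ordS c)) (ordS_neq c h),
  fun k (c : 'I_k) (h : (1 < k)%N) =>
    etrans (eq_sym c (ord_pred c)) (ord_pred_neq c h),
  fun k (c : 'I_k) (h : (2 < k)%N) =>
    etrans (eq_sym (ord_pred c) (ordS c)) (ordS_neq_pred c h)).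
have ru : uniq r by rewrite /= !inE !xpair_eqE !ne// !eqxx.
rewrite [RHS]big_uniq// [RHS]big_mkcond; apply: eq_bigr => -[c d] _.
have -> : adj (s := Tt n m) (c, d) (a, b) = ((c, d) \in r).
  rewrite /= /sym_adj /tri_arc /= !cycle_succE !inE !xpair_eqE.
  (* Every test is solved for [c] or [d]: arcs into [(a, b)] become tests against predecessors, and
     the rest is propositional. *)
  rewrite !(eq_sym a) !(eq_sym b) !(can2_eq (@ordSK _) (@ord_predK _)).
  have [->|ca] := eqVneq c a; have [->|db] := eqVneq d b; rewrite ?ne//=;
  by case: (c == _); case: (c == _); case: (d == _); case: (d == _).
by case: ifP; rewrite ?mulr1 ?mulr0.
Qed.

Section Fourier.
Variables (C : numClosedFieldType) (n m : nat) (u v : C).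
Hypotheses (uP : n.-primitive_root u) (vP : m.-primitive_root v).
Hypotheses (n2 : (2 < n)%N) (m2 : (2 < m)%N).

(** The sum of the character of index [k] over the six neighbours of the origin. *)
Definition torus_eigenvalue (k : 'I_n * 'I_m) : C :=
  let s := u ^+ k.1 in let t := v ^+ k.2 in
  t + s + s * t + (t^-1 + s^-1 + (s * t)^-1).

Lemma prim_expr_ordS l (w : C) (a : nat) (i : 'I_l) : l.-primitive_root w ->
  w ^+ (a * ordS i) = w ^+ (a * i) * w ^+ a.
Proof.
by move=> wP; rewrite /= mulnC exprM (prim_expr_mod wP) -exprM mulSn exprD mulrC (mulnC i).
Qed.

Lemma prim_expr_ord_pred l (w : C) (a : nat) (i : 'I_l) : l.-primitive_root w ->
  w ^+ (a * ord_pred i) = w ^+ (a * i) / w ^+ a.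
Proof.
by move=> wP; rewrite -{2}(ord_predK i) prim_expr_ordS// mulfK// expf_neq0// (prim_root_neq0 wP).
Qed.

Lemma sum_eigenvalues_Tt (V : nmodType) (f : C -> V) :
  \sum_(z <- eigenvalues (adjmx C (Tt n m))) f z =
  \sum_(i < n) \sum_(j < m) f (torus_eigenvalue (i, j)).
Proof.
pose T := vertex (Tt n m).
pose chi (k x : 'I_n * 'I_m) : C := u ^+ (k.1 * x.1) * v ^+ (k.2 * x.2).
(* The rows of [P] are the characters of the product of the two cyclic groups; [Q] is its inverse by
   orthogonality in each coordinate. *)
pose P : 'M[C]_#|T| := \matrix_(k, x) chi (enum_val k) (enum_val x).
pose Q : 'M[C]_#|T| := \matrix_(x, k) ((n * m)%:R^-1 * (chi (enum_val k) (enum_val x))^-1).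
pose d : 'rV[C]_#|T| := \row_k torus_eigenvalue (enum_val k).
have nm0 : (n * m)%:R != 0 :> C.
  by rewrite pnatr_eq0 -lt0n muln_gt0 (ltn_trans _ n2)// (ltn_trans _ m2).
have PQ : P *m Q = 1%:M.
  apply/matrixP => k l; rewrite !mxE.
  under eq_bigr do rewrite !mxE mulrCA.
  rewrite -big_distrr /=.
  rewrite (sum_enum_val (T := T) (fun x => chi (enum_val k) x / chi (enum_val l) x))/=.
  move: (enum_val k) (enum_val l) (inj_eq enum_val_inj k l) => [k1 k2] [l1 l2] /= <-.
  transitivity ((n * m)%:R^-1 * ((\sum_(i < n) u ^+ (k1 * i) * u ^- (l1 * i)) *
     (\sum_(j < m) v ^+ (k2 * j) * v ^- (l2 * j)))).
    congr (_ * _); rewrite big_distrl /=.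
    rewrite (eq_bigr _ (fun i _ => big_distrr _ _ _)) /= pair_big /=.
    by apply: eq_bigr => -[i j] _ /=; rewrite /chi /= invfM mulrACA.
  rewrite (prim_root_orthogonality _ _ uP) (prim_root_orthogonality _ _ vP).
  rewrite -natrM mulnACA [X in _ * X]natrM mulrA mulVf// mul1r.
  by rewrite mulnb xpair_eqE.
have PA : P *m adjmx C (Tt n m) = diag_mx d *m P.
  apply/matrixP => k x; rewrite mul_diag_mx !mxE.
  under eq_bigr do rewrite !mxE.
  rewrite (sum_enum_val (T := T)
    (fun y => chi (enum_val k) y * (adj (s := Tt n m) y (enum_val x))%:R))/=.
  move: (enum_val k) (enum_val x) => [k1 k2] [a b].
  rewrite adj_Tt_sum// !big_cons big_nil /chi /= addr0 /torus_eigenvalue /=.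
  (* A unit shift of a coordinate multiplies the character by a constant, wrap-around included,
     because [u] and [v] are roots of unity. The six constants add up to the eigenvalue. *)
  rewrite !(prim_expr_ordS _ _ uP, prim_expr_ordS _ _ vP,
    prim_expr_ord_pred _ _ uP, prim_expr_ord_pred _ _ vP).
  rewrite invfM; set p := _ ^+ _; set q := _ ^+ _; set s := _ ^+ _; set t := _ ^+ _.
  ring.
rewrite (sum_eigenvalues_diagonalized _ (mulmx1_unit PQ).1 PA).
rewrite pair_big /= -(sum_enum_val (T := T) (fun k => f (torus_eigenvalue (k.1, k.2)))).
by apply: eq_bigr => k _; rewrite mxE -surjective_pairing.
Qed.
End Fourier.

(** * Torus energy as a sum of cosines *)

Section Cis.
Variable R : realType.

Definition cis (t : R) : R[i] := (cos t +i* sin t)%C.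

Lemma cisD s t : cis (s + t) = cis s * cis t.
Proof. apply/eqP; rewrite eq_complex /= cosD sinD; apply/andP; split; apply/eqP; ring. Qed.

Lemma cisX t n : cis t ^+ n = cis (n%:R * t).
Proof.
elim: n => [|n IH]; first by rewrite mul0r /cis cos0 sin0.
by rewrite exprS IH -cisD -natr1 mulrDl mul1r addrC.
Qed.

Lemma cisV t : (cis t)^-1 = cis (- t).
Proof.
have h : cis t * cis (- t) = 1 by rewrite -cisD subrr /cis cos0 sin0.
rewrite -[RHS](mulKf (x := cis t)) ?h ?mulr1//.
by apply: contra_eq_neq h => ->; rewrite mul0r eq_sym oner_eq0.
Qed.

Lemma cisDV t : cis t + (cis t)^-1 = (2 * cos t)%:C%C.
Proof.
rewrite cisV /cis cosN sinN; apply/eqP; rewrite eq_complex /= subrr eqxx andbT.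
by apply/eqP; ring.
Qed.

(** The real part is [1 - 2 sin^2 (t / 2)], and [sin (t / 2)] is positive since [t / 2] lies
    strictly between 0 and [pi]. *)
Lemma cis_neq1 t : 0 < t < 2 * pi -> cis t != 1.
Proof.
move=> /andP[t0 t2]; apply/eqP => /(congr1 (@complex.Re R))/= /eqP; apply/negP.
have {1}-> : t = (t / 2) *+ 2 by rewrite mulr2n; lra.
have s0 : 0 < sin (t / 2) by apply: sin_gt0_pi; apply/andP; split; lra.
rewrite cos_mulr2n cos2sin2; nra.
Qed.

Lemma cis_prim_root n : (0 < n)%N -> n.-primitive_root (cis (2 * pi / n%:R)).
Proof.
move=> n0; have n0' : (n%:R != 0 :> R) by rewrite pnatr_eq0 -lt0n.
apply/andP; split=> //; apply/forallP => i; rewrite unity_rootE cisX.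
have [->|ne] := eqVneq i.+1 n.
  by rewrite mulrC divfK// /cis mulr_natl cos2pi sin2pi eqxx.
have lt : (i.+1 < n)%N by rewrite ltn_neqAle ne ltn_ord.
rewrite eqbF_neg; apply: cis_neq1; rewrite mulrCA; apply/andP; split.
  by rewrite !mulr_gt0 ?pi_gt0// ?invr_gt0 ltr0n.
rewrite gtr_pMr ?mulr_gt0 ?pi_gt0//.
by rewrite ltr_pdivrMr ?ltr0n// mul1r ltr_nat.
Qed.

Lemma energy_Tt n m : (2 < n)%N -> (2 < m)%N ->
  energy R (Tt n m) = \sum_(i < n) \sum_(j < m)
    2 * `|cos (i%:R * (2 * pi / n%:R)) + cos (j%:R * (2 * pi / m%:R)) +
          cos (i%:R * (2 * pi / n%:R) + j%:R * (2 * pi / m%:R))|.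
Proof.
move=> n2 m2; rewrite /energy.
rewrite (sum_eigenvalues_Tt (cis_prim_root (ltnW (ltnW n2)))
  (cis_prim_root (ltnW (ltnW m2))) n2 m2).
apply: eq_bigr => i _; apply: eq_bigr => j _.
rewrite /torus_eigenvalue /= !cisX -cisD.
set t := _ * _; set s := _ * _.
have -> : cis t + cis s + cis (s + t) + ((cis t)^-1 + (cis s)^-1 + (cis (s + t))^-1)
   = (2 * (cos s + cos t + cos (s + t)))%:C%C.
  (* Each term is paired with its inverse, which gives twice a cosine. *)
  rewrite addrACA [X in X + _]addrACA !cisDV -!rmorphD /=; congr (_ %:C)%C; ring.
by rewrite /= expr0n /= addr0 sqrtr_sqr normrM ger0_norm.
Qed.
End Cis.

(** * Riemann sums of Lipschitz functions in one and two variables *)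

Section Riemann.
Local Open Scope classical_set_scope.
Variable R : realType.
Local Notation mu := (@lebesgue_measure R).

Lemma abs_lipschitz_continuous (L : R) (f : R -> R) :
  (forall x y, `|f x - f y| <= L * `|x - y|) -> continuous f.
Proof.
move=> fL x; apply/cvgrPdist_le => e e0; near=> y.
(* [|L| + 1] is a strictly positive Lipschitz constant whatever the sign of [L], so [e] can be
   divided by it. *)
apply: le_trans (fL x y) _; apply: (@le_trans _ _ ((`|L| + 1) * `|x - y|)).
  by rewrite ler_wpM2r// (le_trans (ler_norm L))// lerDl.
rewrite mulrC -ler_pdivlMr ?ltr_wpDl//.
near: y; apply: cvgr_dist_le; first exact: cvg_id.
by rewrite divr_gt0// ltr_wpDl.
Unshelve. all: by end_near. Qed.

Lemma abs_lipschitz_integrable (L : R) (f : R -> R) a b :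
  (forall x y, `|f x - f y| <= L * `|x - y|) -> mu.-integrable `[a, b] (EFin \o f).
Proof.
move=> fL; apply: continuous_compact_integrable; first exact: segment_compact.
exact/continuous_subspaceT/(abs_lipschitz_continuous fL).
Qed.

Lemma Rintegral_cst_itv (c a b : R) : a <= b -> \int[mu]_(x in `[a, b]) c = c * (b - a).
Proof.
move=> ab; rewrite Rintegral_cst//= lebesgue_measure_itv/= lte_fin.
by case: ltgtP ab => //= ->; rewrite subrr.
Qed.

Lemma Rintegral_norm_bound (f : R -> R) (a b c : R) : a <= b ->
  mu.-integrable `[a, b] (EFin \o f) -> (forall x, a <= x <= b -> `|f x| <= c) ->
  `|\int[mu]_(x in `[a, b]) f x| <= c * (b - a).
Proof.
move=> ab fi fc; apply: le_trans (le_normr_Rintegral _ fi) _ => //.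
rewrite -Rintegral_cst_itv//; apply: le_Rintegral => //.
- exact: integrable_norm fi.
- by apply: (@abs_lipschitz_integrable 0) => x y; rewrite subrr normr0 mul0r.
Qed.

(** On the cell, [f] stays within [L * h] of its value at the left end; integrating over length [h]
    gives the second factor. *)
Lemma lipschitz_left_rectangle (L h a : R) (f : R -> R) : 0 <= h ->
  (forall x y, `|f x - f y| <= L * `|x - y|) -> 0 <= L ->
  `|\int[mu]_(x in `[a, a + h]) f x - h * f a| <= L * h ^+ 2.
Proof.
move=> h0 fL L0; have ab : a <= a + h by rewrite lerDl.
have cL : forall x y : R, `|f a - f a| <= L * `|x - y|.
  by move=> x y; rewrite subrr normr0 mulr_ge0.
have -> : h * f a = \int[mu]_(x in `[a, a + h]) (f a).
  by rewrite Rintegral_cst_itv// addrAC subrr add0r mulrC.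
rewrite -RintegralB//; [|exact: abs_lipschitz_integrable fL
                         |exact: abs_lipschitz_integrable cL].
have -> : L * h ^+ 2 = (L * h) * (a + h - a) by ring.
apply: Rintegral_norm_bound => //.
  apply: (@abs_lipschitz_integrable L) => x y.
  have -> : f x - f a - (f y - f a) = f x - f y by ring.
  exact: fL.
move=> x /andP[ax xh]; apply: le_trans (fL _ _) _.
by rewrite ler_wpM2l// ger0_norm; lra.
Qed.

Lemma lipschitz_riemann_sum (L h : R) n (f : R -> R) : 0 <= h -> 0 <= L ->
  (forall x y, `|f x - f y| <= L * `|x - y|) ->
  `|\int[mu]_(x in `[0, n%:R * h]) f x - h * \sum_(i < n) f (i%:R * h)| <=
  n%:R * (L * h ^+ 2).
Proof.
move=> h0 L0 fL; elim: n => [|n IH].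
  by rewrite !mul0r set_itv1 Rintegral_set1 big_ord0 mulr0 subrr normr0.
have int a b := @abs_lipschitz_integrable L f a b fL.
have e : n.+1%:R * h = n%:R * h + h by rewrite -natr1 mulrDl mul1r.
have nh : 0 <= n%:R * h by rewrite mulr_ge0.
(* The last cell is split off. It comes out half-open and is closed without changing its
   integral. *)
have := @Rintegral_itvB R f (BLeft 0) (BRight (n.+1%:R * h)) (n%:R * h) (int _ _).
rewrite !bnd_simp e lerDl => /(_ nh h0).
rewrite Rintegral_itv_obnd_cbnd; last first.
  by apply: integrableS (int (n%:R * h) (n%:R * h + h)) => //; exact: subset_itv_oc_cc.
move/eqP; rewrite subr_eq => /eqP ->; rewrite big_ord_recr /= mulrDr opprD.
rewrite [X in X + _]addrC addrACA -natr1 [leRHS]mulrDl mul1r.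
apply: le_trans (ler_normD _ _) _; apply: lerD => //.
exact: lipschitz_left_rectangle.
Qed.

(** The one-variable estimate is used twice: on the inner integral [G], with error [L b^3 / n], then
    on each slice of [F], with total error [L b^3 / m]. *)
Lemma lipschitz_riemann_sum2 (L b : R) n m (F : R -> R -> R) : 0 <= b -> 0 <= L ->
  (0 < n)%N -> (0 < m)%N ->
  (forall x y x' y', `|F x y - F x' y'| <= L * (`|x - x'| + `|y - y'|)) ->
  `|\int[mu]_(x in `[0, b]) \int[mu]_(y in `[0, b]) F x y
    - b ^+ 2 / (n * m)%:R *
      \sum_(i < n) \sum_(j < m) F (i%:R * (b / n%:R)) (j%:R * (b / m%:R))|
  <= L * b ^+ 3 * (n%:R^-1 + m%:R^-1).
Proof.
move=> b0 L0 n0 m0 FL; pose G x := \int[mu]_(y in `[0, b]) F x y.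
have nr : n%:R != 0 :> R by rewrite pnatr_eq0 -lt0n.
have mr : m%:R != 0 :> R by rewrite pnatr_eq0 -lt0n.
have F2 x y y' : `|F x y - F x y'| <= L * `|y - y'|.
  by apply: le_trans (FL _ _ _ _) _; rewrite subrr normr0 add0r.
have GL x x' : `|G x - G x'| <= (L * b) * `|x - x'|.
  rewrite /G -RintegralB//; try exact: abs_lipschitz_integrable (F2 _).
  have -> : L * b * `|x - x'| = L * `|x - x'| * (b - 0) by ring.
  apply: Rintegral_norm_bound => //.
    (* This crude bound serves only for integrability of the difference of two slices. *)
    have F2' y y' : `|(F x y - F x' y) - (F x y' - F x' y')| <= (L + L) * `|y - y'|.
      have -> : (F x y - F x' y) - (F x y' - F x' y') =
                (F x y - F x y') - (F x' y - F x' y') by ring.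
      by rewrite mulrDl; apply: le_trans (ler_normB _ _) _; apply: lerD.
    exact: abs_lipschitz_integrable F2'.
  by move=> y _; apply: le_trans (FL _ _ _ _) _; rewrite subrr normr0 addr0.
have hn : 0 <= b / n%:R by rewrite divr_ge0.
have hm : 0 <= b / m%:R by rewrite divr_ge0.
have := lipschitz_riemann_sum n hn (mulr_ge0 L0 b0) GL.
rewrite mulrC divfK// => E1.
have E2 : `|b / n%:R * (\sum_(i < n) G (i%:R * (b / n%:R))) -
   b / n%:R * \sum_(i < n) (b / m%:R *
     \sum_(j < m) F (i%:R * (b / n%:R)) (j%:R * (b / m%:R)))|
   <= b / n%:R * (n%:R * (m%:R * (L * (b / m%:R) ^+ 2))).
  rewrite -mulrBr normrM ger0_norm// ler_wpM2l// -sumrB.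
  apply: le_trans (ler_norm_sum _ _ _) _.
  have le (i : 'I_n) := lipschitz_riemann_sum m hm L0 (F2 (i%:R * (b / n%:R))).
  rewrite mulrC divfK// in le.
  apply: le_trans (ler_sum _ (fun i _ => le i)) _.
  by rewrite sumr_const card_ord [leRHS]mulr_natl.
rewrite -mulr_sumr in E2.
have -> : b ^+ 2 / (n * m)%:R = b / n%:R * (b / m%:R).
  by rewrite natrM; field; rewrite nr mr.
rewrite -mulrA.
have -> : L * b ^+ 3 * (n%:R^-1 + m%:R^-1) = n%:R * (L * b * (b / n%:R) ^+ 2) +
    b / n%:R * (n%:R * (m%:R * (L * (b / m%:R) ^+ 2))).
  by field; rewrite nr mr.
apply: le_trans (lerD E1 E2); apply: le_trans (ler_normD _ _).
by rewrite addrA subrK.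
Qed.

Lemma cos_lipschitz (x y : R) : `|cos x - cos y| <= `|x - y|.
Proof.
wlog xy : x y / y <= x.
  by move=> H; have [/H//|/ltW/H] := leP y x; rewrite distrC [leRHS]distrC.
have [c _ ->] := @MVT_segment R cos (fun t => - sin t) y x xy
  (fun t _ => is_derive_cos t) (continuous_subspaceT (@continuous_cos R)).
rewrite normrM normrN -[leRHS]mul1r ler_wpM2r// ler_norml sin_geN1 sin_le1//.
Qed.
End Riemann.

Local Open Scope classical_set_scope.

(** * Energy per site and the joint limit *)

Section JointLimit.
Variable R : realType.

Lemma joint_cvg (K c : R) (u : nat * nat -> R) : 0 <= K ->
  (forall n m, (3 <= n)%N -> (3 <= m)%N ->
    `|c - u (n, m)| <= K * (n%:R^-1 + m%:R^-1)) ->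
  u p @[p --> within [set p : nat * nat | (3 <= p.1)%N /\ (3 <= p.2)%N]
                     (filter_prod \oo \oo)] --> c.
Proof.
move=> K0 uK; apply/cvgrPdist_le => e e0; rewrite near_withinE.
have Ke0 : 0 <= K * 2 / e by rewrite divr_ge0 ?mulr_ge0// ltW.
(* Beyond [N], each of [K / n] and [K / m] is at most [e / 2]. *)
set N := Num.bound (K * 2 / e).
have small n : (3 <= n)%N -> (N <= n)%N -> K * n%:R^-1 <= e / 2.
  move=> n3 Nn; have n0 : 0 < n%:R :> R by rewrite ltr0n (leq_trans _ n3).
  rewrite ler_pdivrMr// -ler_pdivrMl ?divr_gt0//.
  have -> : (e / 2)^-1 * K = K * 2 / e by field; rewrite gt_eqF.
  by apply: le_trans (ltW (archi_boundP Ke0)) _; rewrite ler_nat.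
exists ([set n | (N <= n)%N], [set m | (N <= m)%N]) => /=.
  by split; exists N.
move=> [n m] /= [Nn Nm] [n3 m3]; apply: le_trans (uK _ _ n3 m3) _.
by rewrite mulrDr [leRHS]splitr lerD// small.
Qed.

(** The constant is 2 because each variable enters two of the three cosines, each of them
    1-Lipschitz. *)
Lemma dispersion_lipschitz (x y x' y' : R) :
  `| `|cos x + cos y + cos (x + y)| - `|cos x' + cos y' + cos (x' + y')| |
  <= 2 * (`|x - x'| + `|y - y'|).
Proof.
apply: le_trans (ler_dist_dist _ _) _.
have -> : cos x + cos y + cos (x + y) - (cos x' + cos y' + cos (x' + y')) =
  (cos x - cos x') + (cos y - cos y') + (cos (x + y) - cos (x' + y')) by ring.
have := cos_lipschitz (x + y) (x' + y').
have := ler_normD (x - x') (y - y').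
rewrite addrACA -opprD => h1 h2; have h3 := cos_lipschitz x x'.
have h4 := cos_lipschitz y y'.
apply: le_trans (ler_normD _ _) _.
have := ler_normD (cos x - cos x') (cos y - cos y'); lra.
Qed.

(** With [b = 2 pi], the weight [b^2 / (2 pi^2) = 2] of the Riemann sum matches the factor 2 in the
    eigenvalues. The error constant is [2 b^3 / (2 pi^2) = 8 pi]. *)
Lemma energy_Tt_density n m : (3 <= n)%N -> (3 <= m)%N ->
  `|(2 * pi ^+ 2)^-1 * (\int[lebesgue_measure]_(x in `[0%R, (2 * pi)%R])
      \int[lebesgue_measure]_(y in `[0%R, (2 * pi)%R])
        `|cos x + cos y + cos (x + y)|) - energy R (Tt n m) / (n * m)%:R| <=
  8 * pi * (n%:R^-1 + m%:R^-1).
Proof.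
move=> n3 m3; rewrite energy_Tt//.
have n0 : (0 < n)%N by apply: leq_trans n3.
have m0 : (0 < m)%N by apply: leq_trans m3.
have pi0 : pi != 0 :> R by rewrite gt_eqF// pi_gt0.
have b0 : 0 <= 2 * pi :> R by rewrite mulr_ge0// pi_ge0.
have := lipschitz_riemann_sum2 b0 (ler0n R 2) n0 m0 dispersion_lipschitz.
set I := Rintegral _ _ _; set S := \sum_(i < n) _ => bound.
have nr : n%:R != 0 :> R by rewrite pnatr_eq0 -lt0n.
have mr : m%:R != 0 :> R by rewrite pnatr_eq0 -lt0n.
have c0 : 0 <= (2 * pi ^+ 2)^-1 :> R by rewrite invr_ge0 mulr_ge0// exprn_ge0// pi_ge0.
under eq_bigr do rewrite -mulr_sumr.
rewrite -mulr_sumr -/S.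
have factor (q : R) : q != 0 -> (2 * q ^+ 2)^-1 * I - 2 * S / (n * m)%:R =
    (2 * q ^+ 2)^-1 * (I - (2 * q) ^+ 2 / (n * m)%:R * S).
  by move=> q0; rewrite natrM; field; rewrite nr mr q0.
have collect (q : R) : q != 0 ->
    (2 * q ^+ 2)^-1 * (2 * (2 * q) ^+ 3 * (n%:R^-1 + m%:R^-1)) = 8 * q * (n%:R^-1 + m%:R^-1).
  by move=> q0; field; rewrite nr mr q0.
rewrite factor// normrM (ger0_norm c0) -collect//.
exact: (ler_wpM2l c0 bound).
Qed.

(** Taking any successor relations between path and cycle treats the three boundary conditions at
    once. *)
Lemma energy_density_cvg (sn : forall n, rel 'I_n) (sm : forall m, rel 'I_m) :
  (forall n, subrel (@path_succ n) (@sn n)) ->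
  (forall n, subrel (@sn n) (@cycle_succ n)) ->
  (forall m, subrel (@path_succ m) (@sm m)) ->
  (forall m, subrel (@sm m) (@cycle_succ m)) ->
  (energy R (sgraph_of_arcs (tri_arc (@sn p.1) (@sm p.2))) / (p.1 * p.2)%:R)
    @[p --> within [set p : nat * nat | (3 <= p.1)%N /\ (3 <= p.2)%N]
                   (filter_prod \oo \oo)] -->
  (2 * pi ^+ 2)^-1 * \int[lebesgue_measure]_(x in `[0%R, (2 * pi)%R])
      \int[lebesgue_measure]_(y in `[0%R, (2 * pi)%R])
        `|cos x + cos y + cos (x + y)|.
Proof.
(* [8 * pi] is the Riemann sum error on the torus; 6 comes from the boundary, as
   [6 (n + m) / (n m) = 6 (1/n + 1/m)]. *)
move=> hn hn' hm hm'; apply: (@joint_cvg (8 * pi + 6)).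
  by rewrite addr_ge0// mulr_ge0// pi_ge0.
move=> n m n3 m3; rewrite [leRHS]mulrDl /=.
apply: le_trans (ler_distD (energy R (Tt n m) / (n * m)%:R) _ _) _.
apply: lerD; first exact: energy_Tt_density.
have nr : n%:R != 0 :> R by rewrite pnatr_eq0 -lt0n (leq_trans _ n3).
have mr : m%:R != 0 :> R by rewrite pnatr_eq0 -lt0n (leq_trans _ m3).
rewrite -mulrBl normrM normfV normr_nat.
have -> : 6 * (n%:R^-1 + m%:R^-1) = (6 * (n + m))%:R / (n * m)%:R :> R.
  by rewrite !natrM natrD; field; rewrite nr mr.
by rewrite ler_wpM2r// energy_torus_diff.
Qed.

End JointLimit.

Theorem theorem2p8 (R : realType) :
  let c : R := (2 * pi ^+ 2)^-1 *
    \int[lebesgue_measure]_(x in `[0%R, (2 * pi)%R])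
      \int[lebesgue_measure]_(y in `[0%R, (2 * pi)%R])
        `|cos x + cos y + cos (x + y)| in
  let joint := within [set p : nat * nat | (3 <= p.1)%N /\ (3 <= p.2)%N]
                      (filter_prod \oo \oo) in
  [/\ (energy R (Tt p.1 p.2) / (p.1 * p.2)%:R) @[p --> joint] --> c,
      (energy R (Tc p.1 p.2) / (p.1 * p.2)%:R) @[p --> joint] --> c &
      (energy R (Tf p.1 p.2) / (p.1 * p.2)%:R) @[p --> joint] --> c].
Proof.
move=> c joint; split.
- by apply: (energy_density_cvg (sn := @cycle_succ) (sm := @cycle_succ)) => k // a b;
    exact: path_sub_cycle_succ.
- by apply: (energy_density_cvg (sn := @cycle_succ) (sm := @path_succ)) => k // a b;
    exact: path_sub_cycle_succ.
- by apply: (energy_density_cvg (sn := @path_succ) (sm := @path_succ)) => k // a b;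
    exact: path_sub_cycle_succ.
Qed.
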